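(* Let $n\ge1$, let $\alpha,\beta\vDash n$ be compositions and let $\ell=\ell(\alpha)$. Suppose $\alpha$ is not a diving-board. 1. If $\beta=(1^{\ell-1},n-\ell,1)$, then $\mathrm{SIT}_{\mathfrak{S}^*}(\alpha;\beta)\ne\emptyset$. 2. If $\beta=(1,n-\ell,1^{\ell-1})$, then $\mathrm{SRIT}_{\mathfrak{S}^*}(\alpha;\beta)\ne\emptyset$. 3. If $\beta=(\ell,1^{n-\ell-2},2)$, then $\mathrm{SIT}_{R\mathfrak{S}^*}(\alpha;\beta)\ne\emptyset$. 4. If $\beta=(2,1^{n-\ell-2},\ell)$, then $\mathrm{SRIT}_{R\mathfrak{S}^*}(\alpha;\beta)\ne\emptyset$.
   Context: A composition $\alpha=(\alpha_1,\dots,\alpha_\ell)\vDash n$ is a finite list of positive integers with sum $n$; $\ell(\alpha)=\ell$; $1^m$ denotes $m$ consecutive parts equal to $1$. A composition is a diving-board if at most one of its parts is $\ge2$. Write $\mathrm{Set}(\alpha)=\{\alpha_1,\alpha_1+\alpha_2,\dots,\alpha_1+\cdots+\alpha_{\ell-1}\}\subseteq[n-1]=\{1,\dots,n-1\}$, and let $\mathrm{Comp}$ be the inverse bijection from subsets of $[n-1]$ to compositions of $n$. The diagram of $\alpha$ is the left-justified array of cells with $\alpha_i$ cells in row $i$, rows numbered from bottom to top. $\mathrm{SIT}(\alpha)$ (standard immaculate tableaux) is the set of bijective fillings of the diagram of $\alpha$ with $1,\dots,n$ such that entries increase from bottom to top in the first (leftmost) column and from left to right in each row. $\mathrm{SRIT}(\alpha)$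 (standard reverse immaculate tableaux) is the set of bijective fillings with $1,\dots,n$ such that entries increase from bottom to top in the first (leftmost) column and from right to left in each row. For $T$ in either set, $\mathrm{Des}_{\mathfrak{S}^*}(T)=\{i\in[n-1]\mid i+1$ is in a strictly higher row than $i$ in $T\}$ and $\mathrm{Des}_{R\mathfrak{S}^*}(T)=\{i\in[n-1]\mid i+1$ is in the same row as or a lower row than $i$ in $T\}$. For $\ast\in\{\mathfrak{S}^*,R\mathfrak{S}^*\}$, the $\ast$-descent composition of $T$ is $\mathrm{Comp}(\mathrm{Des}_\ast(T))$, and $\mathrm{SIT}_\ast(\alpha;\beta)$ (resp. $\mathrm{SRIT}_\ast(\alpha;\beta)$) is the set of $T\in\mathrm{SIT}(\alpha)$ (resp. $T\in\mathrm{SRIT}(\alpha)$) with $\ast$-descent composition $\beta$. *)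

(* Defs.v *)
From mathcomp Require Import all_boot.

Set Implicit Arguments.
Unset Strict Implicit.
Unset Printing Implicit Defensive.

(** * Compositions and subsets of [n-1] *)

Definition is_composition (n : nat) (alpha : seq nat) : bool :=
  all (fun a => 0 < a) alpha && (sumn alpha == n).

Definition diving_board (alpha : seq nat) : bool :=
  count (fun a => 2 <= a) alpha <= 1.

(* Integers between 0 and n are represented by 'I_n.+1 with their actual value,
   so that a subset of {1, ..., n-1} is a set that is disjoint from {0, n}. *)
Definition interior (n : nat) : {set 'I_n.+1} :=
  [set i : 'I_n.+1 | 0 < i < n].

Definition set_of_comp (n : nat) (alpha : seq nat) : {set 'I_n.+1} :=
  [set i : 'I_n.+1 | [exists k : 'I_(size alpha),
              (0 < k) && (nat_of_ord i == sumn (take k alpha))]].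

(* [enum A] lists A increasingly, so these are the gaps of 0 < a_1 < ... < n. *)
Definition comp_of_set (n : nat) (A : {set 'I_n.+1}) : seq nat :=
  pairmap (fun a b => b - a) 0 (rcons [seq nat_of_ord i | i <- enum A] n).

(** * Fillings of the diagram of a composition *)

(* Rows are numbered from bottom to top, columns from left to right, both
   from 0. *)
Definition cell (alpha : seq nat) : finType :=
  {i : 'I_(size alpha) & 'I_(nth 0 alpha i)}.

Definition row_of (alpha : seq nat) (c : cell alpha) : nat := tag c.
Definition col_of (alpha : seq nat) (c : cell alpha) : nat := tagged c.

Definition filling (n : nat) (alpha : seq nat) : finType :=
  {ffun cell alpha -> 'I_n.+1}.

Section Tableaux.

Variables (n : nat) (alpha : seq nat).
Implicit Type T : filling n alpha.

(* Bijectivity is onto {1, ..., n}: the value 0 is not taken. *)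
Definition bijective_filling T : bool :=
  injectiveb T && ([set T c | c in cell alpha] == [set i : 'I_n.+1 | 0 < i]).

Definition first_column_increasing T : bool :=
  [forall c, forall d,
     [&& col_of c == 0, col_of d == 0 & row_of c < row_of d] ==> (T c < T d)].

Definition rows_increasing T : bool :=
  [forall c, forall d,
     (row_of c == row_of d) && (col_of c < col_of d) ==> (T c < T d)].

Definition rows_decreasing T : bool :=
  [forall c, forall d,
     (row_of c == row_of d) && (col_of c < col_of d) ==> (T d < T c)].

Definition SIT : {set filling n alpha} :=
  [set T | [&& bijective_filling T, first_column_increasing T
             & rows_increasing T]].

Definition SRIT : {set filling n alpha} :=
  [set T | [&& bijective_filling T, first_column_increasing T
             & rows_decreasing T]].

(* On a bijective filling, c and d are the unique cells that contain i and
   i+1. *)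
Definition DesS T : {set 'I_n.+1} :=
  [set i in interior n | [exists c, exists d,
     [&& T c == i, T d == i.+1 :> nat & row_of c < row_of d]]].

Definition DesRS T : {set 'I_n.+1} :=
  [set i in interior n | [exists c, exists d,
     [&& T c == i, T d == i.+1 :> nat & row_of d <= row_of c]]].

Definition SIT_S (beta : seq nat) : {set filling n alpha} :=
  [set T in SIT | comp_of_set (DesS T) == beta].
Definition SRIT_S (beta : seq nat) : {set filling n alpha} :=
  [set T in SRIT | comp_of_set (DesS T) == beta].
Definition SIT_RS (beta : seq nat) : {set filling n alpha} :=
  [set T in SIT | comp_of_set (DesRS T) == beta].
Definition SRIT_RS (beta : seq nat) : {set filling n alpha} :=
  [set T in SRIT | comp_of_set (DesRS T) == beta].

End Tableaux.

Arguments SIT_S : clear implicits.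
Arguments SRIT_S : clear implicits.
Arguments SIT_RS : clear implicits.
Arguments SRIT_RS : clear implicits.

(** * [comp_of_set] and [set_of_comp] are inverse bijections *)

Lemma sorted_enum_ord m (A : {set 'I_m}) :
  sorted ltn [seq nat_of_ord i | i <- enum A].
Proof.
have -> : enum A = filter (mem A) (enum 'I_m) by rewrite enumT.
rewrite sorted_map; apply: sorted_filter.
  by move=> y x z; apply: ltn_trans.
by rewrite -sorted_map val_enum_ord iota_ltn_sorted.
Qed.

Lemma foldl_addn x (s : seq nat) : foldl addn x s = x + sumn s.
Proof. by elim: s x => [|a s IHs] x /=; rewrite ?addn0 // IHs addnA. Qed.

Lemma path_scanl_addn x (s : seq nat) :
  all (fun a => 0 < a) s -> path ltn x (scanl addn x s).
Proof.
elim: s x => //= a s IHs x /andP[a_gt0 s_gt0].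
by rewrite -[X in X < _]addn0 ltn_add2l a_gt0 IHs.
Qed.

Lemma mem_scanl_addn x (s : seq nat) y :
  y \in scanl addn x s =
  [exists k : 'I_(size s), y == x + sumn (take k.+1 s)].
Proof.
apply/(nthP 0)/existsP; rewrite ?size_scanl.
  case=> k k_lt <-; exists (Ordinal k_lt) => /=.
  by rewrite nth_scanl // foldl_addn.
by case=> -[k k_lt] /= /eqP->; exists k; rewrite // nth_scanl // foldl_addn.
Qed.

Lemma ltn_sumn_take n alpha k : is_composition n alpha ->
  k < size alpha -> sumn (take k alpha) < n.
Proof.
case/andP=> pos /eqP <- k_lt.
rewrite -{2}(cat_take_drop k alpha) sumn_cat -[X in X < _]addn0 ltn_add2l.
rewrite (drop_nth 0) //= ltn_addr //.
by apply: (allP pos); apply: mem_nth.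
Qed.

Lemma sumn_take_gt0 n alpha k : is_composition n alpha ->
  0 < k < size alpha -> 0 < sumn (take k alpha).
Proof.
case/andP=> + _; case: alpha k => [|a s] [|k] //= /andP[a_gt0 _] _.
by rewrite ltn_addr.
Qed.

Lemma set_of_comp_interior n alpha : is_composition n alpha ->
  set_of_comp n alpha \subset interior n.
Proof.
move=> comp_a; apply/subsetP=> i; rewrite !inE.
case/existsP=> k /andP[k_gt0 /eqP->].
by rewrite (ltn_sumn_take comp_a) // (sumn_take_gt0 comp_a) // k_gt0 /=.
Qed.

Lemma sorted_rcons_interior n (A : {set 'I_n.+1}) : 0 < n ->
  A \subset interior n ->
  path ltn 0 (rcons [seq nat_of_ord i | i <- enum A] n).
Proof.
move=> n_gt0 sA; rewrite (path_sortedE ltn_trans); apply/andP; split.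
  rewrite all_rcons n_gt0; apply/allP=> _ /mapP[i + ->].
  by rewrite mem_enum => /(subsetP sA); rewrite inE => /andP[].
rewrite -cats1 (sorted_pairwise ltn_trans) pairwise_cat.
rewrite -(sorted_pairwise ltn_trans) sorted_enum_ord /= andbT.
rewrite allrel1r; apply/allP=> _ /mapP[i + ->].
by rewrite mem_enum => /(subsetP sA); rewrite inE => /andP[].
Qed.

Lemma set_of_comp_scanl n alpha : 0 < n -> is_composition n alpha ->
  rcons [seq nat_of_ord i | i <- enum (set_of_comp n alpha)] n
    = scanl addn 0 alpha.
Proof.
move=> n_gt0 comp_a; have [pos /eqP sum_a] := andP comp_a.
have sz_gt0 : 0 < size alpha.
  by case: alpha sum_a {comp_a pos} => // n0; rewrite -n0 in n_gt0.
apply: (irr_sorted_eq ltn_trans ltnn).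
- exact: path_sorted (sorted_rcons_interior n_gt0 (set_of_comp_interior comp_a)).
- exact: path_sorted (path_scanl_addn 0 pos).
move=> y; rewrite mem_rcons inE mem_scanl_addn; apply/orP/existsP.
  case=> [/eqP->|/mapP[i]].
    have lt : (size alpha).-1 < size alpha by rewrite prednK.
    by exists (Ordinal lt); rewrite /= prednK // take_size add0n sum_a.
  rewrite mem_enum inE => /existsP[k /andP[k_gt0 /eqP ik]] ->.
  have lt : k.-1 < size alpha by rewrite (leq_ltn_trans (leq_pred _)).
  by exists (Ordinal lt); rewrite /= prednK // ik.
case=> k /eqP->; rewrite add0n.
have [lt|ge] := ltnP k.+1 (size alpha); last first.
  by left; rewrite take_oversize // sum_a.
right; have lt' := ltn_sumn_take comp_a lt.
apply/mapP; exists (Ordinal (leqW lt')); rewrite // mem_enum inE.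
by apply/existsP; exists (Ordinal lt) => /=.
Qed.

Lemma set_of_compK n alpha : 0 < n -> is_composition n alpha ->
  comp_of_set (set_of_comp n alpha) = alpha.
Proof.
move=> n_gt0 comp_a; rewrite /comp_of_set (set_of_comp_scanl n_gt0 comp_a).
by apply: scanlK => x y; rewrite addKn.
Qed.

Lemma scanl_pairmap_subn x (s : seq nat) : path ltn x s ->
  scanl addn x (pairmap (fun a b => b - a) x s) = s.
Proof.
by elim: s x => //= y s IHs x /andP[/ltnW/subnKC-> /IHs->].
Qed.

Lemma pairmap_subn_gt0 x (s : seq nat) : path ltn x s ->
  all (fun a => 0 < a) (pairmap (fun a b => b - a) x s).
Proof.
by elim: s x => //= y s IHs x /andP[lt_xy /IHs->]; rewrite subn_gt0 lt_xy.
Qed.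

Lemma sumn_pairmap_subn x (s : seq nat) : path ltn x s ->
  x + sumn (pairmap (fun a b => b - a) x s) = last x s.
Proof.
elim: s x => [|y s IHs] x /=; first by rewrite addn0.
by case/andP=> /ltnW le_xy /IHs <-; rewrite addnA subnKC.
Qed.

Lemma comp_of_set_composition n (A : {set 'I_n.+1}) : 0 < n ->
  A \subset interior n -> is_composition n (comp_of_set A).
Proof.
move=> n_gt0 sA; have path_s := sorted_rcons_interior n_gt0 sA.
apply/andP; split; first exact: pairmap_subn_gt0.
by rewrite -[sumn _]add0n sumn_pairmap_subn // last_rcons.
Qed.

Lemma comp_of_setK n (A : {set 'I_n.+1}) : 0 < n ->
  A \subset interior n -> set_of_comp n (comp_of_set A) = A.
Proof.
move=> n_gt0 sA; have comp_A := comp_of_set_composition n_gt0 sA.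
have := set_of_comp_scanl n_gt0 comp_A.
rewrite {2}/comp_of_set scanl_pairmap_subn ?sorted_rcons_interior //.
move=> /rcons_inj[/(inj_map val_inj) eqA].
by apply/setP=> i; rewrite -mem_enum eqA mem_enum.
Qed.

(* Main.v *)
Require Import Defs.
From mathcomp Require Import all_boot.
From mathcomp Require Import zify.

Set Implicit Arguments.
Unset Strict Implicit.
Unset Printing Implicit Defensive.

(** Two tableaux settle the four claims. As [~~ diving_board alpha], there are
rows [b < t] with at least two cells each; let [l] be the number of rows.
For standard immaculate tableaux, number the cells in the following order: the first column from bottom to top,
then the remaining cells row by row, from the top row to the bottom row and
from left to right, except that the last cell [z] of row [t] is kept for the
very end. Steps inside the first column go up, the later ones stay in a row or
go down, except the last one: the cell before [z] lies in row [b] or below,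
hence [z] is strictly above it. So the descents for the immaculate order are
[1, ..., l - 1] and [n - 1], and the composition is [(1^(l-1), n - l, 1)]. The
reverse descents of the same tableau are the complementary subset
[l, ..., n - 2], whose composition is [(l, 1^(n-l-2), 2)].

For reverse tableaux, turn the diagram upside down and replace every entry [i]
by [n + 1 - i]. First columns stay increasing, rows become decreasing, a step
from [i] to [i + 1] becomes one from [n - i] to [n + 1 - i], and the two
reversals cancel in the direction of the step: both compositions are reversed.

The order is built in [reading_order] for an abstract set of cells with a row
and a column function, because turning the diagram upside down then amounts
to changing the row function into [l - 1 - row]; the type of the cells of the
reversed composition never appears. [SIT_peak] and [SRIT_peak] are the two
instances. *)

(** * Numbering a finite type along an injective key *)

Section Rank.

Variables (C : finType) (key : C -> nat).
Hypothesis key_inj : injective key.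

Definition rank (c : C) : nat := #|[pred d | key d <= key c]|.

Lemma rank_le c d : (rank c <= rank d) = (key c <= key d).
Proof.
have [le_cd|lt_dc] := leqP (key c) (key d).
  by apply/subset_leq_card/subsetP=> e; rewrite !inE => /leq_trans->.
apply/negbTE; rewrite -ltnNge; apply/proper_card/properP; split.
  by apply/subsetP=> e; rewrite !inE => /leq_trans-> //; apply: ltnW.
by exists c; rewrite !inE // -ltnNge.
Qed.

Lemma rank_lt c d : (rank c < rank d) = (key c < key d).
Proof. by rewrite !ltnNge rank_le. Qed.

Lemma rank_inj : injective rank.
Proof.
by move=> c d eq_cd; apply/key_inj/eqP; rewrite eqn_leq -!rank_le eq_cd leqnn.
Qed.

Lemma rank_bounds c : 0 < rank c <= #|C|.
Proof. by rewrite max_card andbT; apply/card_gt0P; exists c; rewrite inE. Qed.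

End Rank.

(** * The order in which the cells are filled *)

Section ReadingOrder.

Variables (C : finType) (row col : C -> nat) (N : nat) (z w : C).
Hypotheses (cell_inj : forall c d, row c = row d -> col c = col d -> c = d)
           (row_lt : forall c, row c < N)
           (col_lt : forall c, col c < N)
           (row_start : forall c, exists2 e, col e = 0 & row e = row c)
           (z_end : forall c, row c = row z -> col c <= col z)
           (z_long : 0 < col z) (w_long : 0 < col w)
           (w_below_z : row w < row z).

(** The three kinds of cells take values in the consecutive ranges [0, N),
[N, N + N * N + N) and the single top value. On cells of the middle kind, the
column is below [N], so that [(N - row c) * N + col c] orders them
lexicographically, by descending rows and then ascending columns. *)
Definition reading_key (c : C) : nat :=
  if col c == 0 then row c
  else if c == z then N + N * N + N
  else N + (N - row c) * N + col c.

Lemma reading_key_col0 c d : col c = 0 ->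
  (reading_key d <= reading_key c) = (col d == 0) && (row d <= row c).
Proof.
rewrite /reading_key => -> /=; have := row_lt c.
by case: (col d == 0) => //=; case: (d == z) => ?; apply/negbTE; lia.
Qed.

Lemma reading_key_max c : reading_key c <= reading_key z.
Proof.
rewrite /reading_key eqxx (gtn_eqF z_long).
have [rc cc] := (row_lt c, col_lt c); have : (N - row c) * N <= N * N.
  by rewrite leq_mul2r leq_subr orbT.
by case: eqP => _; [|case: eqP => _]; lia.
Qed.

Lemma reading_key_rest c d : 0 < col c -> 0 < col d -> c != z -> d != z ->
  (reading_key d <= reading_key c) =
  (row c < row d) || (row c == row d) && (col d <= col c).
Proof.
move=> c_gt0 d_gt0 /negbTE cz /negbTE dz.
rewrite /reading_key (gtn_eqF c_gt0) (gtn_eqF d_gt0) cz dz.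
have [rc cc] := (row_lt c, col_lt c); have [rd cd] := (row_lt d, col_lt d).
have [lt_cd|lt_dc|->] := ltngtP (row c) (row d) => /=.
- have : (N - row d).+1 * N <= (N - row c) * N by rewrite leq_mul2r; lia.
  by rewrite mulSn; lia.
- have : (N - row c).+1 * N <= (N - row d) * N by rewrite leq_mul2r; lia.
  by rewrite mulSn; lia.
- by rewrite leq_add2l.
Qed.

Lemma reading_key_z c : c != z -> reading_key c < reading_key z.
Proof.
move=> /negbTE cz; rewrite /reading_key eqxx (gtn_eqF z_long) cz.
have [rc cc] := (row_lt c, col_lt c); have : (N - row c) * N <= N * N.
  by rewrite leq_mul2r leq_subr orbT.
by case: eqP => _; lia.
Qed.

Lemma reading_key_inj : injective reading_key.
Proof.
move=> c d eq_cd.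
have [c0|c_gt0] := posnP (col c).
  have := reading_key_col0 d c0; rewrite -eq_cd leqnn => /esym/andP[/eqP d0 _].
  by apply: cell_inj; rewrite ?c0 ?d0 //; move: eq_cd; rewrite /reading_key c0 d0.
have [d0|d_gt0] := posnP (col d).
  have := reading_key_col0 c d0; rewrite eq_cd leqnn => /esym/andP[/eqP c0 _].
  by rewrite c0 in c_gt0.
have [cz|cz] := eqVneq c z; have [dz|dz] := eqVneq d z; first by rewrite cz.
- by have := reading_key_z dz; rewrite -eq_cd cz ltnn.
- by have := reading_key_z cz; rewrite eq_cd dz ltnn.
have := reading_key_rest c_gt0 d_gt0 cz dz.
have := reading_key_rest d_gt0 c_gt0 dz cz.
by rewrite eq_cd leqnn => ? ?; apply: cell_inj; lia.
Qed.

Lemma reading_key_row c d :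
  row c = row d -> col c < col d -> reading_key c < reading_key d.
Proof.
move=> eq_row lt_col; have d_gt0 : 0 < col d by apply: leq_ltn_trans lt_col.
rewrite ltnNge; have [c0|c_gt0] := posnP (col c).
  by rewrite (reading_key_col0 _ c0) (gtn_eqF d_gt0).
have [cz|cz] := eqVneq c z.
  by have := @z_end d; rewrite -eq_row cz => /(_ erefl); rewrite -cz leqNgt lt_col.
have [->|dz] := eqVneq d z; first by rewrite -ltnNge reading_key_z.
by rewrite reading_key_rest // eq_row ltnn eqxx /= -ltnNge.
Qed.

(** Let [d] come just after [c]. If [d] is in the first column, so is [c], and
rows go up there. If [d] is [z], then [c] does not come before [w], so it is a
cell of the middle kind in the row of [w] or below. Otherwise [d] has middle
kind: if [c] does too, rows go down weakly, and if [c] is in the first column,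
then it is the last cell of that column, so no row is above its row. *)
Lemma reading_ascent c d : reading_key c < reading_key d ->
    (forall e, reading_key e <= reading_key c \/ reading_key d <= reading_key e) ->
  (row c < row d) = (col d == 0) || (d == z).
Proof.
move=> lt_cd cons.
have [d0|d_gt0] := posnP (col d).
  have := reading_key_col0 c d0; rewrite (ltnW lt_cd) => /esym/andP[/eqP c0 _].
  by move: lt_cd; rewrite ltnNge reading_key_col0 // d0 /= ltnNge.
have cz : c != z.
  by apply: contraTneq lt_cd => ->; rewrite -leqNgt reading_key_max.
have [dz|dz] /= := eqVneq d z.
  have wz : w != z by apply: contraTneq w_below_z => ->; rewrite ltnn.
  have le_wc : reading_key w <= reading_key c.
    by case: (cons w) => //; rewrite dz leqNgt reading_key_z.
  have c_gt0 : 0 < col c.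
    rewrite lt0n; apply/negP=> /eqP c0.
    by move: le_wc; rewrite reading_key_col0 // (gtn_eqF w_long).
  move: le_wc; rewrite reading_key_rest // dz => le_wc.
  apply: leq_ltn_trans w_below_z; lia.
have [c0|c_gt0] := posnP (col c).
  (* The head [e] of the row of [d] comes before [d], so not after [c]. *)
  have [e e0 <-] := row_start d.
  case: (cons e); rewrite reading_key_col0 // ?(gtn_eqF d_gt0) // => /andP[_].
  by rewrite ltnNge => ->.
by move: lt_cd; rewrite ltnNge reading_key_rest // ltnNge; lia.
Qed.

(** The first column is an initial segment of the order and [z] its last
element, so the criterion of [reading_ascent] can be read on the numbers
alone. *)
Lemma reading_order : exists rk : C -> nat,
  [/\ injective rk, forall c, 0 < rk c <= #|C|,
      forall c d, col c = 0 -> col d = 0 -> row c < row d -> rk c < rk d,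
      forall c d, row c = row d -> col c < col d -> rk c < rk d
    & forall c d, rk d = (rk c).+1 -> (row c < row d) =
        (rk c < #|[pred e | col e == 0]|) || (rk d == #|C|)].
Proof.
exists (rank reading_key); split.
- exact/rank_inj/reading_key_inj.
- exact: rank_bounds.
- move=> c d c0 d0 lt_cd; rewrite rank_lt ltnNge reading_key_col0 //.
  by rewrite d0 /= -ltnNge.
- by move=> c d eq_row lt_col; rewrite rank_lt reading_key_row.
move=> c d rk_d; rewrite -rk_d.
have -> : (row c < row d) = (col d == 0) || (d == z).
  apply: reading_ascent => [|e]; first by rewrite -rank_lt rk_d.
  rewrite -!(rank_le reading_key) rk_d.
  by case: (leqP (rank reading_key e) (rank reading_key c)); [left | right].
congr (_ || _).
  apply/eqP/idP=> [d0|].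
    by apply/subset_leq_card/subsetP=> e; rewrite !inE reading_key_col0 // => /andP[].
  apply: contraTeq => d_neq0; rewrite -ltnNge; apply/proper_card/properP; split.
    apply/subsetP=> e; rewrite !inE => /eqP e0; apply: ltnW.
    by rewrite ltnNge reading_key_col0 // (negbTE d_neq0).
  by exists d; rewrite !inE.
have rk_z : rank reading_key z = #|C|.
  by apply: eq_card => e; rewrite !inE reading_key_max.
by rewrite -rk_z (inj_eq (rank_inj reading_key_inj)).
Qed.

End ReadingOrder.

(** * Cells, and fillings given by a numbering *)

Section Fillings.

Variables (n : nat) (alpha : seq nat).
Hypothesis comp_alpha : is_composition n alpha.
Local Notation l := (size alpha).

Lemma part_gt0 i : i < l -> 0 < nth 0 alpha i.
Proof. by move=> lt_i; apply: (allP (andP comp_alpha).1); apply: mem_nth. Qed.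

Definition row_head (i : 'I_l) : cell alpha :=
  Tagged (fun i : 'I_l => 'I_(nth 0 alpha i)) (Ordinal (part_gt0 (ltn_ord i))).

Lemma cell_eq (c d : cell alpha) : row_of c = row_of d -> col_of c = col_of d -> c = d.
Proof.
case: c d => [i j] [i' j']; rewrite /row_of /col_of /=.
by move=> /val_inj eq_i; case: _ / eq_i j' => j' /val_inj->.
Qed.

Lemma card_cell : #|{: cell alpha}| = n.
Proof.
rewrite card_tagged; have [_ /eqP <-] := andP comp_alpha.
congr sumn; under eq_map do rewrite card_ord.
apply: (@eq_from_nth _ 0); rewrite size_map size_enum_ord // => i lt_i.
by rewrite (nth_map (Ordinal lt_i)) ?size_enum_ord // nth_enum_ord.
Qed.

Lemma card_column0 : #|[pred c : cell alpha | col_of c == 0]| = l.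
Proof.
rewrite -[RHS]card_ord -(card_image (f := row_head)); last first.
  by move=> i j /(congr1 (@row_of _)) /val_inj.
apply: eq_card => c; rewrite !inE; apply/eqP/imageP=> [c0|[i _ ->] //].
by exists (tag c) => //; apply: cell_eq.
Qed.

Lemma col_lt_n (c : cell alpha) : col_of c < n.
Proof.
have [_ /eqP <-] := andP comp_alpha; apply: leq_trans (ltn_ord (tagged c)) _.
rewrite -[X in sumn X](cat_take_drop (tag c) alpha) sumn_cat.
by rewrite (drop_nth 0) ?ltn_ord //= addnCA leq_addr.
Qed.

Lemma size_le_n : l <= n.
Proof. by rewrite -card_column0 -card_cell max_card. Qed.

Variable f : cell alpha -> nat.
Hypotheses (f_inj : injective f) (f_bounds : forall c, 0 < f c <= n).

Definition filling_of : filling n alpha := [ffun c => inord (f c)].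

Lemma filling_ofE c : filling_of c = f c :> nat.
Proof. by rewrite ffunE inordK // ltnS; case/andP: (f_bounds c). Qed.

Lemma filling_of_bij : bijective_filling filling_of.
Proof.
have T_inj : injective filling_of.
  by move=> c d /(congr1 val); rewrite /= !filling_ofE => /f_inj.
apply/andP; split; first exact/injectiveP.
rewrite eqEcard; apply/andP; split.
  by apply/subsetP=> _ /imsetP[c _ ->]; rewrite inE filling_ofE; case/andP: (f_bounds c).
rewrite card_imset // card_cell; have -> : [set i : 'I_n.+1 | 0 < i] = ~: [set ord0].
  by apply/setP=> i; rewrite !inE lt0n.
by rewrite cardsC1 card_ord.
Qed.

End Fillings.

(** * Descents of a bijective filling *)

Section Descents.

Variables (n : nat) (alpha : seq nat) (T : filling n alpha) (P : pred nat).
Hypothesis T_bij : bijective_filling T.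

Lemma bij_filling_onto i : 0 < i <= n -> exists c, T c = i :> nat.
Proof.
case/andP=> i_gt0 le_in; have [_ /eqP/setP/(_ (inord i))] := andP T_bij.
rewrite inE inordK // i_gt0 => /imsetP[c _ def_i].
by exists c; rewrite -def_i inordK.
Qed.

Lemma DesS_eq : (forall c d, T d = (T c).+1 :> nat -> (row_of c < row_of d) = P (T c)) ->
  DesS T = [set i in interior n | P i].
Proof.
move=> TP; apply/setP=> i; rewrite !inE; apply: andb_id2l => /andP[i_gt0 lt_in].
apply/existsP/idP=> [[c /existsP[d /and3P[/eqP Tc /eqP Td]]]|Pi].
  by rewrite TP Tc.
have [c Tc] : exists c, T c = i :> nat by apply: bij_filling_onto; lia.
have [d Td] : exists d, T d = i.+1 :> nat by apply: bij_filling_onto.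
exists c; apply/existsP; exists d.
by rewrite TP ?Tc ?Pi ?andbT ?Td // eqxx andbT; apply/eqP/val_inj.
Qed.

(** The two descent sets are complementary in [interior n]: this is why one
tableau serves both claims about its shape. *)
Lemma DesRS_eq : (forall c d, T d = (T c).+1 :> nat -> (row_of c < row_of d) = P (T c)) ->
  DesRS T = [set i in interior n | predC P i].
Proof.
move=> TP; apply/setP=> i; rewrite !inE; apply: andb_id2l => /andP[i_gt0 lt_in].
apply/existsP/idP=> [[c /existsP[d /and3P[/eqP Tc /eqP Td]]]|Pi].
  by rewrite leqNgt TP Tc.
have [c Tc] : exists c, T c = i :> nat by apply: bij_filling_onto; lia.
have [d Td] : exists d, T d = i.+1 :> nat by apply: bij_filling_onto.
exists c; apply/existsP; exists d.
by rewrite leqNgt TP ?Tc ?Pi ?andbT ?Td // eqxx andbT; apply/eqP/val_inj.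
Qed.

End Descents.

(** * The two tableaux *)

Lemma count_gt1_nth (T : Type) (x0 : T) (a : pred T) (s : seq T) : 1 < count a s ->
  exists i j, [/\ i < j < size s, a (nth x0 s i) & a (nth x0 s j)].
Proof.
elim: s => //= x s IHs; case ax: (a x) => /=; last first.
  by case/IHs=> i [j [lt_ij ai aj]]; exists i.+1, j.+1.
rewrite add1n ltnS -has_count => /(has_nthP x0)[j lt_j aj].
by exists 0, j.+1.
Qed.

Section Tableaux.

Variables (n : nat) (alpha : seq nat).
Hypotheses (comp_alpha : is_composition n alpha)
           (not_diving_board : ~~ diving_board alpha).
Local Notation l := (size alpha).

Lemma two_long_rows : exists b t : 'I_l,
  [/\ b < t, 1 < nth 0 alpha b & 1 < nth 0 alpha t].
Proof.
move: not_diving_board; rewrite /diving_board -ltnNge.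
case/(count_gt1_nth 0)=> b [t [/andP[lt_bt lt_t] bP tP]].
by exists (Ordinal (ltn_trans lt_bt lt_t)), (Ordinal lt_t).
Qed.

Lemma row_last (i : 'I_l) : 1 < nth 0 alpha i -> exists z : cell alpha,
  [/\ row_of z = i, 0 < col_of z
    & forall c : cell alpha, row_of c = row_of z -> col_of c <= col_of z].
Proof.
move=> i_gt1; have lt_last : (nth 0 alpha i).-1 < nth 0 alpha i by lia.
exists (Tagged (fun i : 'I_l => 'I_(nth 0 alpha i)) (Ordinal lt_last)).
split=> //; rewrite /col_of /=; first by lia.
case=> j k; rewrite /row_of /col_of /= => /val_inj eq_ji.
by move: (ltn_ord k); rewrite [in X in _ < X]eq_ji; lia.
Qed.

Lemma SIT_peak : exists2 T : filling n alpha, T \in SIT n alpha &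
  forall c d, T d = (T c).+1 :> nat ->
    (row_of c < row_of d) = (T c < l) || (T c == n.-1 :> nat).
Proof.
have [b [t [lt_bt b_gt1 t_gt1]]] := two_long_rows.
have [z [z_row z_col z_end]] := row_last t_gt1.
have [w [w_row w_col _]] := row_last b_gt1.
have [] := @reading_order _ (@row_of alpha) (@col_of alpha) n z w => //.
- exact: cell_eq.
- by move=> c; apply: leq_trans (ltn_ord (tag c)) (size_le_n comp_alpha).
- exact: col_lt_n.
- by move=> c; exists (row_head comp_alpha (tag c)).
- by rewrite w_row z_row.
rewrite (card_cell comp_alpha) (card_column0 comp_alpha).
move=> f [f_inj f_bounds f_col f_row f_asc].
have TE := filling_ofE f_bounds; exists (filling_of n f).
  rewrite inE filling_of_bij //=; apply/andP; split.
    apply/forallP=> c; apply/forallP=> d; apply/implyP=> /and3P[/eqP c0 /eqP d0 lt_cd].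
    by rewrite !TE f_col.
  apply/forallP=> c; apply/forallP=> d; apply/implyP=> /andP[/eqP eq_cd lt_cd].
  by rewrite !TE f_row.
move=> c d; rewrite !TE => fd; rewrite f_asc // fd.
by have := f_bounds d; rewrite fd; lia.
Qed.

(** Upside down, [b] is the higher of the two long rows, so it is the last cell
of row [b] that is numbered last, and it receives the entry [1] once [i] is
replaced by [n + 1 - i]. *)
Lemma SRIT_peak : exists2 T : filling n alpha, T \in SRIT n alpha &
  forall c d, T d = (T c).+1 :> nat ->
    (row_of c < row_of d) = (n - l < T c) || (T c == 1 :> nat).
Proof.
have [b [t [lt_bt b_gt1 t_gt1]]] := two_long_rows.
have [z [z_row z_col z_end]] := row_last b_gt1.
have [w [w_row w_col _]] := row_last t_gt1.
have row_lt (c : cell alpha) : row_of c < l by apply: ltn_ord (tag c).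
have le_ln := size_le_n comp_alpha.
pose rrow (c : cell alpha) := l.-1 - row_of c.
have rrowI c d : rrow c = rrow d -> row_of c = row_of d.
  by rewrite /rrow; have := row_lt c; have := row_lt d; lia.
have rrow_lt c d : (rrow d < rrow c) = (row_of c < row_of d).
  by rewrite /rrow; have := row_lt c; have := row_lt d; lia.
have [] := @reading_order _ rrow (@col_of alpha) n z w => //.
- by move=> c d /rrowI; apply: cell_eq.
- by move=> c; rewrite /rrow; have := row_lt c; lia.
- exact: col_lt_n.
- by move=> c; exists (row_head comp_alpha (tag c)).
- by move=> c /rrowI/z_end.
- by rewrite rrow_lt w_row z_row.
rewrite (card_cell comp_alpha) (card_column0 comp_alpha).
move=> g [g_inj g_bounds g_col g_row g_asc].
pose f c := n.+1 - g c.
have f_inj : injective f.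
  by move=> c d; rewrite /f => eq_f; apply: g_inj; have [gc gd] := (g_bounds c, g_bounds d); lia.
have f_bounds c : 0 < f c <= n by rewrite /f; have := g_bounds c; lia.
have TE := filling_ofE f_bounds; exists (filling_of n f).
  rewrite inE filling_of_bij //=; apply/andP; split.
    apply/forallP=> c; apply/forallP=> d; apply/implyP=> /and3P[/eqP c0 /eqP d0 lt_cd].
    rewrite !TE /f; have := g_col d c d0 c0; rewrite rrow_lt => /(_ lt_cd).
    by have [gc gd] := (g_bounds c, g_bounds d); lia.
  apply/forallP=> c; apply/forallP=> d; apply/implyP=> /andP[/eqP eq_cd lt_cd].
  rewrite !TE /f; have := g_row c d; rewrite /rrow eq_cd => /(_ erefl lt_cd).
  by have [gc gd] := (g_bounds c, g_bounds d); lia.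
move=> c d; rewrite !TE /f => fd; have [gc gd] := (g_bounds c, g_bounds d).
rewrite -rrow_lt g_asc; lia.
Qed.

End Tableaux.

(** * Compositions of the descent sets *)

Lemma mem_set_of_comp n beta (i : 'I_n.+1) : 0 < n -> is_composition n beta ->
  (i \in set_of_comp n beta) = (i < n) && (nat_of_ord i \in scanl addn 0 beta).
Proof.
move=> n_gt0 comp_b; rewrite -(set_of_comp_scanl n_gt0 comp_b) mem_rcons inE.
rewrite mem_map; last exact: val_inj.
rewrite mem_enum; have [|_] := boolP (i \in set_of_comp n beta).
  by move/(subsetP (set_of_comp_interior comp_b)); rewrite inE orbT => /andP[_ ->].
by rewrite orbF; case: ltngtP.
Qed.

Lemma scanl_addn_nseq1 x m : scanl addn x (nseq m 1) = iota x.+1 m.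
Proof. by elim: m x => //= m IHm x; rewrite addn1 IHm. Qed.

Lemma comp_of_set_eq n beta (P : pred nat) : 0 < n -> is_composition n beta ->
  (forall i, 0 < i < n -> (i \in scanl addn 0 beta) = P i) ->
  comp_of_set [set i in interior n | P i] == beta.
Proof.
move=> n_gt0 comp_b betaP; apply/eqP.
rewrite -[RHS](set_of_compK n_gt0 comp_b); congr comp_of_set; apply/setP=> i.
rewrite [in LHS]inE [in X in X && _]inE; have [ni|ni] := boolP (0 < i < n).
  by rewrite (mem_set_of_comp i n_gt0 comp_b) betaP //; case/andP: ni => _ ->.
apply/esym/negbTE; apply: contra ni.
by move/(subsetP (set_of_comp_interior comp_b)); rewrite inE.
Qed.

Theorem corollary6p14 (n : nat) (alpha beta : seq nat)
    (n_ge1 : 1 <= n)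
    (comp_alpha : is_composition n alpha)
    (comp_beta : is_composition n beta)
    (not_diving_board : ~~ diving_board alpha) :
  let l := size alpha in
  [/\ beta = nseq (l - 1) 1 ++ [:: n - l; 1] ->
        SIT_S n alpha beta != set0,
      beta = [:: 1; n - l] ++ nseq (l - 1) 1 ->
        SRIT_S n alpha beta != set0,
      beta = [:: l] ++ nseq (n - l - 2) 1 ++ [:: 2] ->
        SIT_RS n alpha beta != set0
    & beta = [:: 2] ++ nseq (n - l - 2) 1 ++ [:: l] ->
        SRIT_RS n alpha beta != set0].
Proof.
move=> l.
have [T T_SIT TP] := SIT_peak comp_alpha not_diving_board.
have [U U_SRIT UP] := SRIT_peak comp_alpha not_diving_board.
have T_bij : bijective_filling T by move: T_SIT; rewrite inE => /and3P[].
have U_bij : bijective_filling U by move: U_SRIT; rewrite inE => /and3P[].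
have sum_beta : sumn beta = n by case/andP: comp_beta => _ /eqP.
have beta_pos : all (leq 1) beta by case/andP: comp_beta.
pose P i := (i < l) || (i == n.-1); pose Q i := (n - l < i) || (i == 1).
split=> def_beta; apply/set0Pn; [exists T | exists U | exists T | exists U];
  rewrite inE ?T_SIT ?U_SRIT /=;
  rewrite ?(DesS_eq (P := P) T_bij TP) ?(DesRS_eq (P := P) T_bij TP)
    ?(DesS_eq (P := Q) U_bij UP) ?(DesRS_eq (P := Q) U_bij UP).
(* The partial sums of each composition form explicit intervals; comparing them
   with [P] or [Q] uses the sum and positivity of [beta], which give the bounds
   on [l] that make the truncated subtractions exact. *)
all: apply: comp_of_set_eq => // i ni; move: sum_beta beta_pos; rewrite def_beta /P /Q /=.
all: rewrite ?scanl_cat /= ?sumn_cat ?all_cat /= ?sumn_nseq ?foldl_addn.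
all: rewrite ?scanl_addn_nseq1 ?sumn_nseq /= ?inE ?mem_cat ?mem_iota ?inE.
all: lia.
Qed.
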